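(* Let $S$ be a bilateral weighted shift on a complex Hilbert space $\mathcal{H}$ with orthonormal basis $(e_n)_{n\in\mathbb{Z}}$ and bounded weight sequence $(\omega_n)_{n\in\mathbb{Z}}$ of positive real numbers, i.e. $Se_n=\omega_n e_{n+1}$ for all $n\in\mathbb{Z}$. Let $\mathcal{H}_0$ be the set of all finite linear combinations of the vectors $e_n$ $(n\in\mathbb{Z})$. For every non-zero $x\in\mathcal{H}_0$, $$\sigma_S(x)=\{\lambda\in\mathbb{C}:r_2^-(S)\le|\lambda|\le r_3^+(S)\}.$$
   Context: Put $\beta_n=\omega_0\cdots\omega_{n-1}$ for $n>0$, $\beta_0=1$, and $\beta_n=\frac{1}{\omega_n\cdots\omega_{-1}}$ for $n<0$. Define $r_2^-(S)=\liminf_{n\to+\infty}[1/\beta_{-n}]^{1/n}$ and $r_3^+(S)=\limsup_{n\to+\infty}\beta_n^{1/n}$. (The set on the right-hand side is empty if $r_2^-(S)>r_3^+(S)$.) For a bounded linear operator $T$ on $\mathcal{H}$ and $x\in\mathcal{H}$, the local resolvent set $\rho_T(x)$ is the union of all open $U\subset\mathbb{C}$ for which there is an analytic $f:U\to\mathcal{H}$ with $(T-\lambda)f(\lambda)=x$ for all $\lambda\in U$; the local spectrum is $\sigma_T(x)=\mathbb{C}\setminus\rho_T(x)$. *)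

(* Defs.v *)
From mathcomp Require Import all_boot all_order all_algebra.
From mathcomp Require Import sesquilinear complex.
From mathcomp Require Import all_classical all_reals all_analysis.

Set Implicit Arguments.
Unset Strict Implicit.
Unset Printing Implicit Defensive.

Import Order.TTheory GRing.Theory Num.Theory.
Import numFieldNormedType.Exports.

Local Open Scope classical_set_scope.
Local Open Scope ring_scope.
Local Open Scope complex_scope.

(* A complex Hilbert space is a complete normed space [H] over [R[i]] together
   with an inner product [dot] inducing its norm; [dot] is linear in its first
   argument and conjugate-linear in the second. *)
Definition inner_product_norm (R : realType) (H : completeNormedModType R[i])
    (dot : {dot H for (@Num.conj R[i])}) : Prop :=
  forall x : H, `|x| ^+ 2 = dot x x.

Definition finite_span (R : realType) (H : completeNormedModType R[i])
    (e : int -> H) : set H :=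
  [set x | exists (s : seq int) (c : int -> R[i]),
     x = \sum_(n <- s) c n *: e n].

Definition orthonormal_basis (R : realType) (H : completeNormedModType R[i])
    (dot : {dot H for (@Num.conj R[i])}) (e : int -> H) : Prop :=
  (forall m n : int, dot (e m) (e n) = (m == n)%:R) /\
  closure (finite_span e) = setT.

(* For a linear map, continuity is boundedness. *)
Definition bilateral_weighted_shift (R : realType)
    (H : completeNormedModType R[i]) (e : int -> H) (w : int -> R)
    (S : {linear H -> H}) : Prop :=
  continuous S /\ forall n : int, S (e n) = (w n)%:C *: e (n + 1).

(* [Negz m] is the integer -(m+1). *)
Definition beta (R : realType) (w : int -> R) (n : int) : R :=
  match n with
  | Posz m => \prod_(0 <= i < m) w i%:Z
  | Negz m => (\prod_(0 <= i < m.+1) w (- (i.+1)%:Z))^-1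
  end.

Definition r2_minus (R : realType) (w : int -> R) : \bar R :=
  limn_einf (fun n : nat => ((1 / beta w (- n%:Z)) `^ (n%:R^-1))%:E).

Definition r3_plus (R : realType) (w : int -> R) : \bar R :=
  limn_esup (fun n : nat => ((beta w n%:Z) `^ (n%:R^-1))%:E).

(* Analyticity of a Banach-space-valued function on an open subset of the
   complex plane: the limit of (f (z + h) - f z) / h as the complex number h
   tends to 0 exists, in norm, at every point z.  The type [R[i]^o] is [R[i]]
   seen as a one-dimensional normed space over itself, with the usual topology
   of the complex plane. *)
Definition analytic_on (R : realType) (H : completeNormedModType R[i])
    (U : set R[i]) (f : R[i] -> H) : Prop :=
  forall z : R[i], U z -> derivable (f : R[i]^o -> H) z 1.

(* Functions defined on [U] only are represented by arbitrary total extensions;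
   [U] being open, the values of [f] outside [U] play no role. *)
Definition local_resolvent_set (R : realType)
    (H : completeNormedModType R[i]) (T : H -> H) (x : H) : set R[i] :=
  \bigcup_(U in [set U : set R[i] | open (U : set R[i]^o) /\
      exists f : R[i] -> H, analytic_on U f /\
        forall lam : R[i], U lam -> T (f lam) - lam *: f lam = x]) U.

Definition local_spectrum (R : realType)
    (H : completeNormedModType R[i]) (T : H -> H) (x : H) : set R[i] :=
  ~` local_resolvent_set T x.

(* Main.v *)
Require Import Defs.
From mathcomp Require Import all_boot all_order all_algebra.
From mathcomp Require Import sesquilinear complex.
From mathcomp Require Import all_classical all_reals all_analysis.
From mathcomp Require Import ring lra zify.

Set Implicit Arguments.
Unset Strict Implicit.
Unset Printing Implicit Defensive.

Import Order.TTheory GRing.Theory Num.Theory.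
Import numFieldNormedType.Exports.

Local Open Scope classical_set_scope.
Local Open Scope ring_scope.
Local Open Scope complex_scope.

(** Rescaling the basis to [v n := beta n *: e n] turns the shift into
[S (v n) = v (n + 1)].  If [g n] is the coordinate of a vector [v] on [v n] and
[y n] that of [x], then [S v - z v = x] becomes the two-term recurrence
[g n - z g (n + 1) = y (n + 1)], whose right-hand side is finitely supported;
on either side of the support of [y], it reads [g n = z ^ k g (n + k)].

Off the annulus, power series provide local resolvents.  For [|z| > r3] take
[f z = - sum_k z ^ (- k - 1) S^k x]: since [S^k (v 0) = v k] has norm [beta k],
it converges as soon as [|z|] exceeds the root growth rate of [beta k]
([growth_iter], [local_resolvent_outer]).  For [|z| < r2] follow a backward
orbit [S (a 0) = x], [S (a (k + 1)) = a k] made of vectors [v (- k)] and take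
[f z = sum_k z ^ k a k] ([backward_orbit], [local_resolvent_inner]).  Such
series are analytic because their divided differences are power series of the
same kind ([powser_divided_difference]).

In the annulus, let [f] be a local resolvent on an open set [U].  To the right
of the support, membership of [f z] in the Hilbert space forces
[beta n <= C |z| ^ n] unless [g] vanishes there, so [g] vanishes there when
[|z| < r3]; likewise to the left when [|z| > r2] ([ncoef_right_eq0],
[ncoef_left_eq0]).  The coordinates of [f] are continuous, so both conclusions
extend to [r2 <= |z| <= r3].  When [r2 = r3] the annulus is only a circle, and
this passage to the limit is what makes the argument work: every non-zero point
of it is approached from the inside and from the outside.  Telescoping the recurrence
across the support then gives [sum_j y_j z ^ j = 0] at all [z] in [U] of
modulus [|lam|], an infinite set when [lam] is non-zero, hence [y = 0] and
[x = 0].  For [lam = 0] the coordinates of [f] vanish one after the other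
starting from the left, and the recurrence at [z = 0] kills [y] along the way
([annulus_not_local_resolvent]). *)

(** * Root growth rates and geometric bounds *)

Lemma limn_esup_lt_near (R : realType) (u : nat -> \bar R) (l : \bar R) :
  (limn_esup u < l)%E -> \forall n \near \oo, (u n < l)%E.
Proof.
move=> /ereal_inf_lt[_ [V Voo <-] supl].
apply: filterS Voo => n Vn; apply: le_lt_trans supl.
by apply: ereal_sup_ubound; exists n.
Qed.

Lemma limn_esup_le_near (R : realType) (u : nat -> \bar R) (l : \bar R) :
  (\forall n \near \oo, (u n <= l)%E) -> (limn_esup u <= l)%E.
Proof.
move=> ul; apply: (@le_trans _ _ (ereal_sup (u @` [set n | (u n <= l)%E]))).
  by apply: ereal_inf_lbound; exists [set n | (u n <= l)%E].
by apply: ge_ereal_sup => _ [n ? <-].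
Qed.

Lemma limn_einf_gt_near (R : realType) (u : nat -> \bar R) (l : \bar R) :
  (l < limn_einf u)%E -> \forall n \near \oo, (l < u n)%E.
Proof.
rewrite lteNr => /limn_esup_lt_near.
by apply: filterS => n; rewrite lteN2.
Qed.

Lemma limn_einf_ge_near (R : realType) (u : nat -> \bar R) (l : \bar R) :
  (\forall n \near \oo, (l <= u n)%E) -> (l <= limn_einf u)%E.
Proof.
move=> ul; rewrite leeNr; apply: limn_esup_le_near.
by apply: filterS ul => n; rewrite leeN2.
Qed.

Lemma powR_invnK (R : realType) (a : R) (n : nat) :
  0 <= a -> (0 < n)%N -> (a `^ n%:R^-1) ^+ n = a.
Proof.
move=> a0 n0; rewrite -powR_mulrn ?powR_ge0// -powRrM mulVf ?powRr1//.
by rewrite pnatr_eq0 -lt0n.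
Qed.

(** The finitely many exceptional terms only affect the constant. *)
Lemma near_le_geometric (R : realType) (u : nat -> R) (r : R) : 0 < r ->
  (forall n, 0 < u n) -> (\forall n \near \oo, u n <= r ^+ n) ->
  exists C, forall n, u n <= C * r ^+ n.
Proof.
move=> r0 u0 [N _ uN].
have t0 n : 0 <= u n / r ^+ n by rewrite divr_ge0 ?exprn_ge0// ltW.
exists (1 + \sum_(k < N) u k / r ^+ k) => n; have [Nn|nN] := leqP N n.
  apply: le_trans (uN _ Nn) _; rewrite ler_peMl ?exprn_ge0 ?(ltW r0)//.
  by rewrite lerDl sumr_ge0.
rewrite -ler_pdivrMr ?exprn_gt0// (bigD1 (Ordinal nN))//= addrCA lerDl.
by rewrite addr_ge0// sumr_ge0.
Qed.

Lemma limn_esup_lt_geometric (R : realType) (u : nat -> R) (r : R) :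
  (forall n, 0 < u n) ->
  (limn_esup (fun n => (u n `^ n%:R^-1)%:E) < r%:E)%E ->
  exists C, forall n, u n <= C * r ^+ n.
Proof.
move=> u0 /limn_esup_lt_near ur.
have r0 : 0 < r.
  have [N _ /(_ N (leqnn N))] := ur; rewrite /= lte_fin.
  exact: le_lt_trans (powR_ge0 _ _).
apply: near_le_geometric => //; near=> n.
rewrite -[leLHS](@powR_invnK _ _ n) ?(ltW (u0 n))//; last by near: n; exists 1%N.
rewrite lerXn2r ?nnegrE ?powR_ge0 ?(ltW r0)// ltW// -lte_fin.
by near: n.
Unshelve. all: by end_near. Qed.

Lemma limn_einf_gt_geometric (R : realType) (u : nat -> R) (r : R) : 0 < r ->
  (forall n, 0 < u n) ->
  (r%:E < limn_einf (fun n => (u n `^ n%:R^-1)%:E))%E ->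
  exists C, forall n, (u n)^-1 <= C * r^-1 ^+ n.
Proof.
move=> r0 u0 /limn_einf_gt_near ur.
apply: (@near_le_geometric _ (fun n => (u n)^-1)).
- by rewrite invr_gt0.
- by move=> n; rewrite invr_gt0.
near=> n.
rewrite exprVn lef_pV2 ?posrE ?exprn_gt0//.
rewrite -[leRHS](@powR_invnK _ _ n) ?(ltW (u0 n))//; last by near: n; exists 1%N.
rewrite lerXn2r ?nnegrE ?powR_ge0 ?(ltW r0)// ltW// -lte_fin.
by near: n.
Unshelve. all: by end_near. Qed.

(** Constants disappear under n-th roots: [C ^ (1 / n)] tends to 1.  In this
multiplicative form no root needs to be taken. *)
Lemma near_geometric_le (R : realType) (C a b : R) : 0 <= a -> a < b ->
  \forall n \near \oo, C * a ^+ n <= b ^+ n.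
Proof.
move=> a0 ab; have b0 : 0 < b by exact: le_lt_trans ab.
have : C * (a / b) ^+ n @[n --> \oo] --> (0 : R).
  apply: cvg_geometric; rewrite ger0_norm ?divr_ge0 ?(ltW b0)//.
  by rewrite ltr_pdivrMr ?mul1r.
move=> /cvgrPdist_le /(_ 1 ltr01); apply: filterS => n.
rewrite sub0r normrN => /(le_trans (ler_norm _)).
by rewrite expr_div_n mulrA ler_pdivrMr ?exprn_gt0// mul1r.
Qed.

Lemma limn_esup_le_geometric (R : realType) (u : nat -> R) (C a : R) :
  0 <= a -> (forall n, 0 < u n) ->
  (\forall n \near \oo, u n <= C * a ^+ n) ->
  (limn_esup (fun n => (u n `^ n%:R^-1)%:E) <= a%:E)%E.
Proof.
move=> a0 u0 uC; apply/lee_addgt0Pr => e e0.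
rewrite -EFinD; apply: limn_esup_le_near.
have ae : a < a + e by rewrite ltrDl.
have abs := @near_geometric_le _ C a (a + e) a0 ae.
near=> n; have n0 : (0 < n)%N by near: n; exists 1%N.
rewrite lee_fin -(@ler_pXn2r _ n)// ?nnegrE ?powR_ge0 ?addr_ge0 ?(ltW e0)//.
rewrite powR_invnK ?(ltW (u0 n))//.
apply: (@le_trans _ _ (C * a ^+ n)); near: n; [exact: uC|exact: abs].
Unshelve. all: by end_near. Qed.

Lemma limn_einf_ge_geometric (R : realType) (u : nat -> R) (C a : R) :
  0 <= a -> (forall n, 0 < u n) ->
  (\forall n \near \oo, a ^+ n <= C * u n) ->
  (a%:E <= limn_einf (fun n => (u n `^ n%:R^-1)%:E))%E.
Proof.
move=> a0 u0 uC; apply/lee_subgt0Pr => e e0.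
rewrite -EFinD; apply: limn_einf_ge_near.
have [ae|ea] := lerP a e.
  near=> n; rewrite lee_fin; apply: le_trans (powR_ge0 _ _).
  by rewrite subr_le0.
have ae : a - e < a by rewrite gtrBl.
have ae0 : 0 <= a - e by rewrite subr_ge0 ltW.
have C0 : 0 < C.
  have [N _ /(_ N (leqnn N)) /=] := uC => h.
  by rewrite -(pmulr_lgt0 _ (u0 N)); apply: lt_le_trans h; rewrite exprn_gt0// (lt_trans e0).
have abs := @near_geometric_le _ C (a - e) a ae0 ae.
near=> n; have n0 : (0 < n)%N by near: n; exists 1%N.
rewrite lee_fin -(@ler_pXn2r _ n)// ?nnegrE ?powR_ge0//.
rewrite powR_invnK ?(ltW (u0 n))// -(ler_pM2l C0).
apply: (@le_trans _ _ (a ^+ n)); near: n; [exact: abs|exact: uC].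
Unshelve. all: by end_near. Qed.

(** * Power series with coefficients in a complex Banach space *)

Lemma complex_normE (R : realType) (z : R[i]) : `|z| = (Normc.normc z)%:C.
Proof. by case: z. Qed.

Lemma normc_ge0 (R : realType) (z : R[i]) : 0 <= Normc.normc z.
Proof. by rewrite -lecR -complex_normE normr_ge0. Qed.

(** In the partial order of [R[i]], a positive element is a positive real; the
radii of balls in the scalar line or in a normed space over [R[i]] can thus be
taken in [R]. *)
Lemma complex_gt0P (R : realType) (e : R[i]) :
  0 < e -> exists2 d : R, 0 < d & e = d%:C.
Proof.
move=> e0; have /complex_realP[d ed] : e \is Num.real by exact: gtr0_real.
by exists d => //; rewrite -ltcR -ed.
Qed.

Lemma normed_real (R : realType) (V : normedModType R[i]) (v : V) :
  exists2 t : R, 0 <= t & `|v| = t%:C.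
Proof.
have /complex_realP[t vt] : `|v| \is Num.real by exact: normr_real.
by exists t => //; rewrite -lecR -vt normr_ge0.
Qed.

Definition geometric_growth (R : realType) (V : normedModType R[i])
    (s : R) (a : nat -> V) :=
  exists C : R, forall k, `|a k| <= (C * s ^+ k)%:C.

Definition powser (R : realType) (V : normedModType R[i])
    (a : nat -> V) (z : R[i]) : V :=
  limn (series (fun k => z ^+ k *: a k)).

Lemma powser_term_le (R : realType) (V : normedModType R[i])
    (C s : R) (a : nat -> V) z k :
  (forall k, `|a k| <= (C * s ^+ k)%:C) ->
  `|z ^+ k *: a k| <= (C * (s * Normc.normc z) ^+ k)%:C.
Proof.
move=> aC; rewrite normrZ normrX complex_normE -rmorphXn/=.
rewrite exprMn mulrA [leRHS]rmorphM/= mulrC.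
by apply: ler_wpM2r; rewrite ?aC// lecR exprn_ge0// normc_ge0.
Qed.

(** The partial sums are dominated by those of a real geometric series, whose
Cauchy property is transferred to the complex norm. *)
Lemma cvg_powser (R : realType) (V : completeNormedModType R[i])
    (s : R) (a : nat -> V) z :
  0 <= s -> geometric_growth s a -> s * Normc.normc z < 1 ->
  series (fun k => z ^+ k *: a k) @ \oo --> powser a z.
Proof.
move=> s0 [C aC] sz; set q := s * _ in sz.
have q0 : 0 <= q by rewrite mulr_ge0// normc_ge0.
suff : cvgn (series (fun k => z ^+ k *: a k)) by [].
have : cauchy (series (geometric C q) @ \oo).
  by apply: cvg_cauchy; apply: is_cvg_geometric_series; rewrite ger0_norm.
move=> /cauchy_seriesP Cq; apply/cauchy_cvgP/cauchy_seriesP => e /complex_gt0P[d d0 ->].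
have := Cq d d0; apply: filterS => n /= nd.
apply: le_lt_trans (ler_norm_sum _ _ _) _.
apply: (@le_lt_trans _ _ (\sum_(n.1 <= k < n.2) geometric C q k)%:C); last first.
  by rewrite ltcR; apply: le_lt_trans nd; exact: ler_norm.
rewrite rmorph_sum/=; apply: ler_sum => k _; exact: powser_term_le.
Qed.

Lemma powser_unique (R : realType) (V : normedModType R[i]) (a : nat -> V) z l :
  series (fun k => z ^+ k *: a k) @ \oo --> l -> powser a z = l.
Proof. by move=> ?; apply: norm_cvg_lim. Qed.

Lemma cvg_norm_le (R : realType) (V : normedModType R[i]) (u : nat -> V) (l : V) (M : R) :
  u @ \oo --> l -> (forall n, `|u n| <= M%:C) -> `|l| <= M%:C.
Proof.
move=> ul uM; have [t t0 lt] := normed_real l; rewrite lt lecR.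
apply/ler_addgt0Pr => e e0.
have /cvgrPdist_le/(_ e%:C) := ul; rewrite ltcR => /(_ e0)[N _ /(_ N (leqnn N)) /= h].
rewrite -lecR -lt rmorphD/= addrC -[l](subrK (u N)).
by apply: le_trans (ler_normD _ _) _; apply: lerD.
Qed.

Lemma powser_le (R : realType) (V : completeNormedModType R[i])
    (C s : R) (a : nat -> V) z :
  0 <= s -> (forall k, `|a k| <= (C * s ^+ k)%:C) -> s * Normc.normc z < 1 ->
  `|powser a z| <= (C / (1 - s * Normc.normc z))%:C.
Proof.
move=> s0 aC sz; have q0 : 0 <= s * Normc.normc z by rewrite mulr_ge0// normc_ge0.
have C0 : 0 <= C.
  by have := aC 0; rewrite expr0 mulr1 -lecR; exact: le_trans (normr_ge0 _).
apply: (cvg_norm_le (cvg_powser s0 (ex_intro _ C aC) sz)) => n.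
apply: le_trans (ler_norm_sum _ _ _) _.
apply: (@le_trans _ _ (\sum_(0 <= k < n) geometric C (s * Normc.normc z) k)%:C).
  by rewrite rmorph_sum/=; apply: ler_sum => k _; exact: powser_term_le.
rewrite lecR -[leLHS]/(series _ n) geometric_seriesE ?lt_eqF// ler_pM2r ?invr_gt0 ?subr_gt0//.
by rewrite ler_piMr// gerBl exprn_ge0.
Qed.

Lemma geometric_growth_shift (R : realType) (V : normedModType R[i])
    (s : R) (a : nat -> V) m :
  geometric_growth s a -> geometric_growth s (fun k => a (m + k)%N).
Proof.
move=> [C aC]; exists (C * s ^+ m) => k.
by apply: le_trans (aC _) _; rewrite exprD mulrA.
Qed.

Lemma powser_step (R : realType) (V : completeNormedModType R[i])
    (s : R) (a : nat -> V) z :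
  0 <= s -> geometric_growth s a -> s * Normc.normc z < 1 ->
  powser a z = a 0 + z *: powser (fun k => a k.+1) z.
Proof.
move=> s0 ga sz; apply: powser_unique.
rewrite -cvg_shiftS /=.
rewrite (_ : (fun n => _) = fun n => a 0 + z *: series (fun k => z ^+ k *: a k.+1) n).
  apply: cvgD; first exact: cvg_cst.
  apply: cvgZl_tmp; exact: cvg_powser s0 (geometric_growth_shift 1 ga) sz.
apply/funext => n; rewrite /series/= big_nat_recl// expr0 scale1r; congr (_ + _).
by rewrite scaler_sumr; apply: eq_bigr => k _; rewrite scalerA -exprS.
Qed.


(** Synthetic division of a power series by [z - z0].  The coefficients of the
quotient, [b j = sum_k z0 ^ k a (j + 1 + k)], satisfy
[b j = a (j + 1) + z0 b (j + 1)]; being values of power series themselves, they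
grow no faster than [a].  The quotient is therefore in the same class, so
that continuity and derivability of power series reduce to bounds. *)
Lemma powser_divided_difference (R : realType) (V : completeNormedModType R[i])
    (s : R) (a : nat -> V) (z0 : R[i]) :
  0 <= s -> geometric_growth s a -> s * Normc.normc z0 < 1 ->
  exists2 b, geometric_growth s b & forall z, s * Normc.normc z < 1 ->
    powser a z - powser a z0 = (z - z0) *: powser b z.
Proof.
move=> s0 ga sz0; pose b j := powser (fun k => a (j.+1 + k)%N) z0.
have gb : geometric_growth s b.
  have [C aC] := ga; exists (C * s / (1 - s * Normc.normc z0)) => j.
  rewrite [X in X%:C](_ : _ = C * s ^+ j.+1 / (1 - s * Normc.normc z0)); last first.
    by rewrite exprS; ring.
  apply: powser_le => // k; apply: le_trans (aC _) _.
  by rewrite exprD mulrA.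
exists b => // z sz.
have bE j : b j = a j.+1 + z0 *: b j.+1.
  rewrite /b (powser_step s0 (geometric_growth_shift _ ga) sz0) addn0.
  by under [in LHS]eq_fun do rewrite addnS -addSn.
have aE : powser a z0 = a 0 + z0 *: b 0%N by rewrite (powser_step s0 ga sz0).
apply/eqP; rewrite subr_eq; apply/eqP; apply: powser_unique.
rewrite aE -cvg_shiftS /=.
pose B := series (fun k => z ^+ k *: b k).
rewrite (_ : (fun n => _) =
    fun n => (z *: B n - z0 *: B n.+1) + (a 0 + z0 *: b 0)).
  apply: cvgD; last exact: cvg_cst.
  have Bl : B @ \oo --> powser b z by exact: cvg_powser s0 gb sz.
  rewrite scalerBl; apply: cvgB; apply: cvgZl_tmp => //.
  by rewrite (cvg_shiftS B).
apply/funext => n; rewrite /B /series/= !big_nat_recl// !expr0 !scale1r.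
rewrite [RHS](_ : _ = a 0 + (z *: \sum_(0 <= k < n) z ^+ k *: b k
    - z0 *: \sum_(0 <= k < n) z ^+ k.+1 *: b k.+1)); last first.
  by rewrite scalerDr opprD addrCA; congr (_ + _); rewrite addrA addrAC subrK.
congr (_ + _); rewrite !scaler_sumr -sumrB.
apply: eq_bigr => k _; rewrite bE !scalerDr !scalerA.
by rewrite ?mulrA -exprS [z0 * _]mulrC addrK.
Qed.

(** * Derivability on the scalar line *)

(** The statements of this part are made over an arbitrary numeric field and in
terms of norms only; they translate the topological notions on the scalar line
into inequalities, which are then used over [R[i]]. *)
Lemma open_regularP (K : numFieldType) (U : set K) :
  open (U : set K^o) <->
  forall z, U z -> exists2 d, 0 < d & forall y, `|y - z| < d -> U y.
Proof.
rewrite openE; split=> oU z Uz.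
  have /nbhs_ballP[d d0 dU] := oU z Uz.
  by exists d => // y yz; apply: dU; rewrite -ball_normE /= distrC.
have [d d0 dU] := oU z Uz; apply/nbhs_ballP; exists d => //= y.
by rewrite -ball_normE /= distrC => /dU.
Qed.

Lemma derivable_quadratic_remainder (K : numFieldType) (V : normedModType K)
    (f : K -> V) (z : K) (c : V) (M d : K) : 0 <= M -> 0 < d ->
  (forall y, `|y - z| < d -> `|f y - f z - (y - z) *: c| <= M * `|y - z| ^+ 2) ->
  derivable (f : K^o -> V) z 1.
Proof.
move=> M0 d0 fc; apply/cvg_ex; exists c; apply/cvgrPdist_le => e e0.
have M1 : 0 < M + 1 by rewrite ltr_wpDl.
near=> h.
have hn0 : h != 0 by near: h; exact: nbhs_dnbhs_neq.
have hd : `|h| < d by near: h; exact: dnbhs0_lt.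
have he : `|h| <= e / (M + 1).
  by near: h; apply: dnbhs0_le; rewrite divr_gt0.
rewrite /= [h%:A]mulr1 distrC.
rewrite -[c](scalerK hn0) -scalerBr normrZ normfV ler_pdivrMl ?normr_gt0//.
have := fc (h + z); rewrite addrK => /(_ hd)/le_trans; apply.
rewrite expr2 mulrCA ler_wpM2l//.
apply: (@le_trans _ _ (M * (e / (M + 1)))); first by rewrite ler_wpM2l.
by rewrite mulrCA ler_piMr ?(ltW e0)// ler_pdivrMr// mul1r lerDl.
Unshelve. all: by end_near. Qed.

Lemma derivable_comp_inv (K : numFieldType) (V : normedModType K)
    (f : K -> V) (z : K) : z != 0 -> derivable (f : K^o -> V) z^-1 1 ->
  derivable ((fun y => f y^-1) : K^o -> V) z 1.
Proof.
move=> z0 /derivable1_diffP fz; apply/derivable1_diffP.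
apply: (@differentiable_comp _ _ _ _ (GRing.inv : K^o -> K^o) f) => //.
exact: differentiable_Rinv.
Qed.

Lemma derivable_continuous_norm (K : numFieldType) (V : normedModType K)
    (f : K -> V) (z : K) : derivable (f : K^o -> V) z 1 ->
  forall e, 0 < e -> exists2 d, 0 < d & forall y, `|y - z| < d -> `|f y - f z| < e.
Proof.
move=> /derivable1_diffP/differentiable_continuous/cvgrPdist_lt fz e e0.
have /nbhs_ballP[d d0 dU] := fz e e0; exists d => // y yz.
by rewrite distrC; apply: dU; rewrite -ball_normE /= distrC.
Qed.

(** * Local resolvents given by power series *)

Lemma growth_const_ge0 (R : realType) (V : normedModType R[i]) (C s : R) (a : nat -> V) :
  (forall k, `|a k| <= (C * s ^+ k)%:C) -> 0 <= C.
Proof.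
by move=> /(_ 0); rewrite expr0 mulr1 -lecR; exact: le_trans (normr_ge0 _).
Qed.

(** The radius leaves [z] in a disk of radius [t] with [s * t < 1], where
[powser_le] bounds the divided difference uniformly. *)
Lemma powser_lipschitz (R : realType) (V : completeNormedModType R[i])
    (s : R) (a : nat -> V) (z0 : R[i]) :
  0 < s -> geometric_growth s a -> s * Normc.normc z0 < 1 ->
  exists2 d : R, 0 < d & exists2 M : R, 0 <= M &
    forall z, `|z - z0| < d%:C -> s * Normc.normc z < 1 /\
      `|powser a z - powser a z0| <= M%:C * `|z - z0|.
Proof.
move=> s0 ga sz0.
have [b [C bC] dE] := powser_divided_difference (ltW s0) ga sz0.
have C0 := growth_const_ge0 bC.
have zs : Normc.normc z0 < s^-1 by rewrite -(ltr_pM2l s0) mulfV ?gt_eqF.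
pose t := (Normc.normc z0 + s^-1) / 2.
have ts : s * t < 1.
  by rewrite -(@ltr_pM2l _ s^-1) ?invr_gt0// mulKf ?gt_eqF// /t; lra.
exists (t - Normc.normc z0); first by rewrite /t; lra.
exists (C / (1 - s * t)); first by rewrite divr_ge0// subr_ge0 ltW.
move=> z zd.
have zt : Normc.normc z <= t.
  rewrite -[z](subrK z0); apply: le_trans (le_normcD _ _) _.
  by move: zd; rewrite complex_normE ltcR; lra.
have szt : s * Normc.normc z <= s * t by rewrite ler_pM2l.
have sz : s * Normc.normc z < 1 by apply: le_lt_trans ts.
split=> //; rewrite dE// normrZ mulrC; apply: ler_wpM2r => //.
apply: le_trans (powser_le (ltW s0) bC sz) _.
by rewrite lecR ler_wpM2l// lef_pV2 ?posrE ?subr_gt0// lerD2l lerN2.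
Qed.

(** The remainder at [z] is [(y - z) (b y - b z)], with [b] the divided
difference, and [b] is Lipschitz near [z]. *)
Lemma derivable_powser (R : realType) (V : completeNormedModType R[i])
    (s : R) (a : nat -> V) (z : R[i]) :
  0 < s -> geometric_growth s a -> s * Normc.normc z < 1 ->
  derivable (powser a : R[i]^o -> V) z 1.
Proof.
move=> s0 ga sz; have [b gb dE] := powser_divided_difference (ltW s0) ga sz.
have [d d0 [M M0 bM]] := powser_lipschitz s0 gb sz.
apply: (@derivable_quadratic_remainder _ _ _ _ (powser b z) M%:C d%:C); rewrite ?lecR ?ltcR//.
move=> y /bM[sy byM]; rewrite dE// -scalerBr normrZ expr2 mulrCA.
exact: ler_wpM2l.
Qed.

Lemma linear_powser (R : realType) (V : completeNormedModType R[i])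
    (S : {linear V -> V}) (s : R) (a : nat -> V) (z : R[i]) :
  continuous S -> 0 <= s -> geometric_growth s a -> s * Normc.normc z < 1 ->
  S (powser a z) = powser (fun k => S (a k)) z.
Proof.
move=> cS s0 ga sz; apply/esym/powser_unique.
rewrite (_ : series _ = S \o series (fun k => z ^+ k *: a k)).
  apply: continuous_cvg; first exact: cS.
  exact: cvg_powser s0 ga sz.
apply/funext => n; rewrite /series/= linear_sum.
by apply: eq_bigr => k _; rewrite linearZ.
Qed.

Lemma open_normc_lt (R : realType) (r : R) :
  open ([set z | Normc.normc z < r] : set R[i]^o).
Proof.
apply/open_regularP => z /= zr.
exists (r - Normc.normc z)%:C; first by rewrite ltcR subr_gt0.
move=> y; rewrite complex_normE ltcR => yz.
rewrite -[y](subrK z); apply: le_lt_trans (le_normcD _ _) _.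
by rewrite -ltrBrDr.
Qed.

Lemma open_normc_gt (R : realType) (r : R) :
  open ([set z | r < Normc.normc z] : set R[i]^o).
Proof.
apply/open_regularP => z /= zr.
exists (Normc.normc z - r)%:C; first by rewrite ltcR subr_gt0.
move=> y; rewrite complex_normE ltcR -normcN opprB => yz.
have := le_normcD (z - y) y; rewrite subrK; lra.
Qed.

(** The resolvent is [sum_k z ^ k a k]: applying [S] shifts the coefficients by
one step, which is multiplication by [z] up to the constant term [S (a 0) = x]. *)
Lemma local_resolvent_inner (R : realType) (H : completeNormedModType R[i])
    (S : {linear H -> H}) (x : H) (a : nat -> H) (r : R) (lam : R[i]) :
  continuous S -> S (a 0) = x -> (forall k, S (a k.+1) = a k) ->
  0 < r -> geometric_growth r^-1 a -> Normc.normc lam < r ->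
  local_resolvent_set S x lam.
Proof.
move=> cS Sa0 SaS r0 ga lr; exists [set z | Normc.normc z < r] => //.
have V0 : 0 < r^-1 by rewrite invr_gt0.
have V0' := ltW V0.
have inD z : Normc.normc z < r -> r^-1 * Normc.normc z < 1.
  by move=> zr; rewrite mulrC ltr_pdivrMr// mul1r.
split; first exact: open_normc_lt.
exists (powser a); split=> z /= /inD zD; first exact: derivable_powser ga zD.
have gSa : geometric_growth r^-1 (fun k => S (a k)).
  have [C aC] := ga; have C0 := growth_const_ge0 aC.
  have [t t0 St] := normed_real (S (a 0)).
  exists (t + C * r) => -[|k].
    by rewrite St expr0 mulr1 lecR lerDl mulr_ge0// ltW.
  rewrite SaS; apply: le_trans (aC _) _; rewrite lecR mulrDl exprS.
  rewrite -[leLHS]add0r lerD ?mulr_ge0 ?exprn_ge0//.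
  by rewrite mulrA mulfK ?gt_eqF.
rewrite (linear_powser cS V0' ga zD) (powser_step V0' gSa zD).
by rewrite Sa0 (_ : (fun k => S (a k.+1)) = a) ?addrK//; exact/funext.
Qed.

(** The resolvent is the Neumann series [- sum_k z ^ (- k - 1) S^k x], a power
series in [z^-1] without constant term. *)
Lemma local_resolvent_outer (R : realType) (H : completeNormedModType R[i])
    (S : {linear H -> H}) (x : H) (r : R) (lam : R[i]) :
  continuous S -> 0 < r -> geometric_growth r (fun k => iter k S x) ->
  r < Normc.normc lam ->
  local_resolvent_set S x lam.
Proof.
move=> cS r0 [C xC] lr; exists [set z | r < Normc.normc z] => //.
have r0' := ltW r0; have C0 := growth_const_ge0 xC.
have inD z : r < Normc.normc z -> r * Normc.normc z^-1 < 1.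
  by move=> rz; rewrite Normc.normcV ltr_pdivrMr ?mul1r// (lt_trans r0).
have nz0 z : r < Normc.normc z -> z != 0.
  by apply: contraTneq => ->; rewrite Normc.normc0 -leNgt.
split; first exact: open_normc_gt.
pose a k := if k is k'.+1 then - iter k' S x else 0.
have ga : geometric_growth r a.
  exists (C / r) => -[|k] /=; first by rewrite normr0 lecR mulr_ge0 ?divr_ge0.
  by rewrite normrN exprS mulrA divfK ?gt_eqF.
exists (fun z => powser a z^-1); split=> z /= zr.
  by apply: derivable_comp_inv (nz0 z zr) _; exact: derivable_powser ga (inD z zr).
have zD := inD z zr.
rewrite (powser_step r0' ga zD) add0r.
have ga1 := geometric_growth_shift 1 ga.
rewrite linearZ/= (linear_powser cS r0' ga1 zD).
rewrite (powser_step r0' ga1 zD) scalerA mulfV ?nz0// scale1r.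
rewrite -[X in powser X](_ : (fun k => a k.+2) = _); last first.
  by apply/funext => k /=; rewrite linearN.
by rewrite opprD opprK addrC subrK.
Qed.

(** * Coordinates and orbits of a bilateral weighted shift *)

Lemma beta_gt0 (R : realType) (w : int -> R) (n : int) :
  (forall n, 0 < w n) -> 0 < beta w n.
Proof. by move=> w0; case: n => m /=; rewrite ?invr_gt0; apply: prodr_gt0. Qed.

Lemma betaS (R : realType) (w : int -> R) (n : int) :
  (forall n, 0 < w n) -> beta w (n + 1) = w n * beta w n.
Proof.
move=> w0; case: n => [m|[|m]].
- by rewrite -PoszD addn1 /= big_nat_recr//= mulrC.
- by rewrite /= big_nil big_nat1 mulfV// gt_eqF.
- rewrite (_ : Negz m.+1 + 1 = Negz m)/=; last by lia.
  rewrite [in RHS]big_nat_recr//= invfM mulrCA.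
  by rewrite mulfV ?mulr1// gt_eqF.
Qed.

Section Shift.
Variables (R : realType) (H : completeNormedModType R[i]).
Variables (dot : {dot H for (@Num.conj R[i])}) (e : int -> H).
Hypotheses (hdot : inner_product_norm dot) (he : orthonormal_basis dot e).
Variables (w : int -> R) (w_gt0 : forall n : int, 0 < w n).
Variables (S : {linear H -> H}) (hS : bilateral_weighted_shift e w S).

Lemma basis_norm n : `|e n| = 1.
Proof.
by apply/eqP; rewrite -sqrp_eq1// hdot he.1 !eqxx.
Qed.

(** Bessel's inequality for one vector: [v - c e n] is orthogonal to [e n]. *)
Lemma coord_le_norm v n : `|dot v (e n)| <= `|v|.
Proof.
set c := dot v (e n).
have ue : dot (v - c *: e n) (c *: e n) = 0.
  rewrite linearBl/= linearZl_LR/= !linearZr_LR/= he.1 eqxx -/c.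
  by rewrite mulr1; exact: subrr.
have : `|v| ^+ 2 = `|v - c *: e n| ^+ 2 + `|c *: e n| ^+ 2.
  by rewrite !hdot -{1 2}[v](subrK (c *: e n)); exact: hnormDd.
rewrite normrZ basis_norm mulr1 => vE.
by rewrite -(@ler_pXn2r _ 2) ?nnegrE ?normr_ge0// vE lerDr exprn_ge0.
Qed.

Definition shifted_basis n : H := (beta w n)%:C *: e n.

Lemma shifted_basisS n : S (shifted_basis n) = shifted_basis (n + 1).
Proof.
by rewrite /shifted_basis linearZ/= hS.2 scalerA -rmorphM/= mulrC -betaS.
Qed.

Lemma norm_shifted_basis n : `|shifted_basis n| = (beta w n)%:C.
Proof.
by rewrite normrZ basis_norm mulr1 ger0_norm// lecR ltW// beta_gt0.
Qed.

Lemma finite_span_ind (P : H -> Prop) :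
  P 0 -> (forall c x y, P x -> P y -> P (c *: x + y)) ->
  (forall n, P (shifted_basis n)) -> forall x, finite_span e x -> P x.
Proof.
move=> P0 PD Po x [s [c ->]]; elim: s => [|n s IH]; first by rewrite big_nil.
have b0 : (beta w n)%:C != 0 by rewrite fmorph_eq0 gt_eqF// beta_gt0.
by rewrite big_cons -[e n](scalerK b0) scalerA; exact: PD (Po n) IH.
Qed.

(** The vectors whose forward orbit grows like [r ^ k] form a subspace, which
contains [S x] if and only if it contains [x]; since [S] moves the rescaled
basis by one step, the vector of index 0 brings all the others in. *)
Lemma growth_iter r : 0 < r -> geometric_growth r (fun k => shifted_basis k%:Z) ->
  forall x, finite_span e x -> geometric_growth r (fun k => iter k S x).
Proof.
move=> r0 go; apply: finite_span_ind.
- exists 0 => k; rewrite mul0r (_ : iter k S 0 = 0) ?normr0//.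
  by elim: k => //= k ->; rewrite linear0.
- move=> c x y [C xC] [D yD]; have [t t0 ct] := normed_real (V := R[i]^o) c.
  exists (t * C + D) => k; rewrite (_ : iter k S _ = c *: iter k S x + iter k S y).
    apply: le_trans (ler_normD _ _) _; rewrite mulrDl rmorphD/= lerD//.
    by rewrite normrZ ct -mulrA [leRHS]rmorphM/= ler_wpM2l// lecR.
  by elim: k => //= k ->; rewrite linearP.
have P0 : geometric_growth r (fun k => iter k S (shifted_basis 0)).
  congr geometric_growth: go; apply/funext; elim=> //= k <-.
  by rewrite shifted_basisS -addn1 PoszD.
have PS n : geometric_growth r (fun k => iter k S (shifted_basis n)) <->
    geometric_growth r (fun k => iter k S (shifted_basis (n + 1))).
  rewrite -shifted_basisS; split=> [/(geometric_growth_shift 1)|[C nC]].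
    by congr geometric_growth; apply/funext => k; rewrite -iterSr.
  have C0 := growth_const_ge0 nC.
  exists (beta w n + C / r) => -[|k].
    by rewrite /= norm_shifted_basis expr0 mulr1 lecR lerDl divr_ge0// ltW.
  rewrite iterSr; apply: le_trans (nC k) _; rewrite lecR mulrDl.
  rewrite exprS [_ / r * _]mulrA divfK ?gt_eqF// lerDr.
  by rewrite !mulr_ge0 ?exprn_ge0 ?(ltW r0)// ltW// beta_gt0.
elim/int_rec => // n Pn; first by rewrite -addn1 PoszD; exact: (PS n).1.
have := (PS (- n.+1%:Z)).2; rewrite (_ : - n.+1%:Z + 1 = - n%:Z); last by lia.
exact.
Qed.

(** Backward orbits can be added and scaled, and prepending [x] to a backward
orbit of [x] gives one of [S x].  A rescaled basis vector of index [- m] has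
the obvious backward orbit, and those of positive index are reached by applying
[S]. *)
Lemma backward_orbit s : 0 < s -> geometric_growth s (fun k => shifted_basis (- k%:Z)) ->
  forall x, finite_span e x ->
  exists a, [/\ S (a 0%N) = x, forall k, S (a k.+1) = a k & geometric_growth s a].
Proof.
move=> s0 go; apply: finite_span_ind.
- exists (fun=> 0); rewrite linear0; split=> //.
  by exists 0 => k; rewrite mul0r normr0.
- move=> c x y [a [a0 aS [C aC]]] [b [b0 bS [D bD]]].
  have [t t0 ct] := normed_real (V := R[i]^o) c.
  exists (fun k => c *: a k + b k); split; first by rewrite linearP a0 b0.
    by move=> k; rewrite linearP aS bS.
  exists (t * C + D) => k.
  apply: le_trans (ler_normD _ _) _; rewrite mulrDl rmorphD/= lerD//.
  by rewrite normrZ ct -mulrA [leRHS]rmorphM/= ler_wpM2l// lecR.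
have Qneg (m : nat) : exists a, [/\ S (a 0%N) = shifted_basis (- m%:Z),
    forall k, S (a k.+1) = a k & geometric_growth s a].
  exists (fun k => shifted_basis (- (m.+1 + k)%N%:Z)); split.
  - by rewrite shifted_basisS; congr shifted_basis; lia.
  - by move=> k; rewrite shifted_basisS; congr shifted_basis; lia.
  - exact: geometric_growth_shift m.+1 go.
elim/int_rec => [|n [a [a0 aS [C aC]]]|n _]; [exact: (Qneg 0%N)| |exact: Qneg].
have C0 := growth_const_ge0 aC.
exists (fun k => if k is k'.+1 then a k' else shifted_basis n); split.
- by rewrite shifted_basisS -PoszD addn1.
- by case.
- exists (beta w n + C / s) => -[|k].
    by rewrite /= norm_shifted_basis expr0 mulr1 lecR lerDl divr_ge0// ltW.
  apply: le_trans (aC k) _; rewrite lecR mulrDl.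
  rewrite exprS [_ / s * _]mulrA divfK ?gt_eqF// lerDr.
  by rewrite !mulr_ge0 ?exprn_ge0 ?(ltW s0)// ltW// beta_gt0.
Qed.

(** Both sides are continuous and linear in [v], and agree on the basis, hence
on its span, which is dense.  The defect [g] of the identity is small at [v]
because it is zero at nearby vectors of the span. *)
Lemma coord_shift v n : dot (S v) (e (n + 1)) = (w n)%:C * dot v (e n).
Proof.
pose g u := dot (S u) (e (n + 1)) - (w n)%:C * dot u (e n).
have gP c u u' : g (c *: u + u') = c * g u + g u'.
  by rewrite /g linearP !linearPl/= mulrBr mulrDr opprD addrACA mulrCA.
have g0 u : finite_span e u -> g u = 0.
  move=> [s [c ->]]; elim: s => [|m s IH].
    by rewrite big_nil /g linear0 !linear0l mulr0 subrr.
  rewrite big_cons gP IH addr0 /g hS.2 linearZl_LR/= !he.1 (inj_eq (addIr 1)).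
  by case: eqVneq => [->|_]; rewrite ?mulr1 ?mulr0 subrr mulr0.
have gN u v' : g (u - v') = g u - g v' by rewrite -[u - _]addrC -scaleN1r gP mulN1r addrC.
apply/eqP; rewrite -subr_eq0 -/(g v) -normr_le0; apply/negPn/negP => gv.
have gv0 : 0 < `|g v| by move: gv; rewrite normr_le0 normr_gt0.
have wn0 : 0 <= (w n)%:C by rewrite lecR ltW.
(* The radius is such that [(1 + w n) * d < |g v|]. *)
pose d := `|g v| / (1 + (w n)%:C + 1).
have w0 : 0 < 1 + (w n)%:C + 1 :> R[i].
  by rewrite ltr_wpDl// addr_ge0.
have d0 : 0 < d by rewrite divr_gt0.
have : closure (finite_span e) v by rewrite he.2.
move=> /(_ ([set u | `|S v - S u| < d] `&` [set u | `|v - u| < d])).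
case; first apply: filterI.
- by have /cvgrPdist_lt := hS.1 v; exact.
- by have /cvgrPdist_lt := @cvg_id _ (nbhs v); exact.
move=> u [/g0 gu [/= Su uv]].
suff : `|g v| < `|g v| by rewrite ltxx.
rewrite -[g v in ltLHS]subr0 -gu -gN /g.
apply: le_lt_trans (ler_normB _ _) _.
apply: (@le_lt_trans _ _ (d + (w n)%:C * d)).
  apply: lerD.
    by apply: le_trans (coord_le_norm _ _) _; rewrite linearB ltW.
  rewrite normrM ger0_norm//; apply: ler_wpM2l => //.
  by apply: le_trans (coord_le_norm _ _) _; rewrite ltW.
rewrite -[X in X + _]mul1r -mulrDl /d mulrCA gtr_pMr// ltr_pdivrMr// mul1r.
by rewrite ltrDl.
Qed.

Lemma span_coord_eq0 x : finite_span e x -> (forall n, dot x (e n) = 0) -> x = 0.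
Proof.
move=> [s [c xE]] x0; apply/eqP.
rewrite -normr_eq0 -sqrf_eq0 hdot {2}xE linear_sumr/= big1// => n _.
by rewrite linearZr_LR/= x0 mulr0.
Qed.

Lemma span_coord_support x : finite_span e x ->
  exists K : nat, forall n, (K < `|n|)%N -> dot x (e n) = 0.
Proof.
move=> [s [c ->]]; exists (\max_(n <- s) `|n|%N) => n nK.
rewrite linear_sumlz/= big1_seq// => m /= ms.
rewrite linearZl_LR/= he.1; case: eqVneq => [mn|_]; last by rewrite mulr0.
by move: nK; rewrite -mn ltnNge leq_bigmax_seq.
Qed.

End Shift.

(** * Two-term recurrences, and zeros on an arc of circle *)

Lemma homogeneous_recurrence (F : fieldType) (z : F)
    (g y : int -> F) (n : int) (k : nat) :
  (forall n, g n - z * g (n + 1) = y (n + 1)) ->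
  (forall j : nat, (j < k)%N -> y (n + j.+1%:Z) = 0) ->
  g n = z ^+ k * g (n + k%:Z).
Proof.
move=> gy; elim: k => [|k IH] y0; first by rewrite expr0 mul1r addr0.
rewrite IH; last by move=> j jk; apply: y0; rewrite ltnS ltnW.
have := gy (n + k%:Z); rewrite (_ : n + k%:Z + 1 = n + k.+1%:Z); last by lia.
by rewrite y0// => /subr0_eq ->; rewrite mulrA -exprSr.
Qed.

Lemma recurrence_telescope (F : fieldType) (z : F) (g y : int -> F) (n : int) (k : nat) :
  (forall n, g n - z * g (n + 1) = y (n + 1)) ->
  g n - z ^+ k * g (n + k%:Z) = \sum_(j < k) y (n + j.+1%:Z) * z ^+ j.
Proof.
move=> gy; elim: k => [|k IH]; first by rewrite big_ord0 expr0 mul1r addr0 subrr.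
rewrite big_ord_recr/= -IH -[n + k.+1%:Z](_ : n + k%:Z + 1 = _); last by lia.
by rewrite -gy exprSr; ring.
Qed.

Lemma r3_plus_ge0 (R : realType) (w : int -> R) : (0 <= r3_plus w)%E.
Proof.
rewrite leNgt; apply/negP => /limn_esup_lt_near[N _ /(_ N (leqnn N))].
by rewrite /= lte_fin ltNge powR_ge0.
Qed.

(** The Cayley transform parametrizes the unit circle minus [-1]; it provides
infinitely many points of any arc around 1 without trigonometry. *)
Definition cayley (R : realType) (t : R) : R[i] := (1 +i* t) / (1 +i* (- t)).

Lemma normc_cayley_den (R : realType) (t : R) :
  1 <= Normc.normc (1 +i* (- t)) /\ Normc.normc (1 +i* t) = Normc.normc (1 +i* (- t)).
Proof.
rewrite /Normc.normc sqrrN; split=> //.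
by rewrite -[leLHS]sqrtr1 ler_wsqrtr// expr1n lerDl sqr_ge0.
Qed.

Lemma cayley_den_neq0 (R : realType) (t : R) : (1 +i* (- t)) != 0 :> R[i].
Proof. by rewrite eq_complex/= oner_eq0. Qed.

Lemma normc_cayley (R : realType) (t : R) : Normc.normc (cayley t) = 1.
Proof.
have [d1 dE] := normc_cayley_den t.
by rewrite Normc.normcM Normc.normcV dE mulfV// gt_eqF// (lt_le_trans _ d1).
Qed.

Lemma cayley_near1 (R : realType) (t : R) : Normc.normc (cayley t - 1) <= 2 * `|t|.
Proof.
have [d1 _] := normc_cayley_den t.
have -> : cayley t - 1 = (0 +i* (2 * t)) / (1 +i* (- t)).
  apply: (mulIf (cayley_den_neq0 t)); rewrite mulrBl !divfK ?cayley_den_neq0//.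
  by apply/eqP; rewrite eq_complex/=; apply/andP; split; apply/eqP; ring.
rewrite Normc.normcM Normc.normcV ler_pdivrMr ?(lt_le_trans _ d1)//.
rewrite /Normc.normc/= expr0n/= add0r sqrtr_sqr normrM ger0_norm//.
by rewrite ler_peMr// mulr_ge0.
Qed.

Lemma cayley_inj (R : realType) : injective (@cayley R).
Proof.
move=> s t /eqP; rewrite eqr_div ?cayley_den_neq0// => /eqP.
rewrite /GRing.mul/= => -[_]; lra.
Qed.

(** The arc contains infinitely many roots, namely the points
[z * cayley (t k)] for a sequence [t k] of distinct parameters. *)
Lemma poly_vanish_arc (R : realType) (p : {poly R[i]}) (z : R[i]) (d : R) :
  z != 0 -> 0 < d ->
  (forall y, Normc.normc (y - z) < d -> Normc.normc y = Normc.normc z -> p.[y] = 0) ->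
  p = 0.
Proof.
move=> z0 d0 pz; apply/eqP/negPn/negP => pn0.
have nz : 0 < Normc.normc z by rewrite -ltcR -complex_normE normr_gt0.
(* [cayley_near1] gives [|y k - z| <= 2 |z| t k = d / (k + 2) < d]. *)
pose t k : R := d / (2 * Normc.normc z) / k.+2%:R.
have t0 k : 0 < t k by rewrite !divr_gt0// mulr_gt0.
pose y k := z * cayley (t k).
have yinj : injective y.
  move=> j k /(mulfI z0)/cayley_inj/(mulfI _)/invr_inj/eqP.
  rewrite gt_eqF ?divr_gt0 ?mulr_gt0// => /(_ isT).
  by rewrite eqr_nat eqSS eqSS => /eqP.
have := @max_poly_roots _ p [seq y k | k <- iota 0 (size p)] pn0.
rewrite size_map size_iota ltnn map_inj_uniq ?iota_uniq//.
suff -> : all (root p) [seq y k | k <- iota 0 (size p)] by move=> /(_ isT isT).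
apply/allP => _ /mapP[k _ ->]; apply/rootP/pz; last first.
  by rewrite Normc.normcM normc_cayley mulr1.
rewrite -[X in _ - X]mulr1 -mulrBr Normc.normcM.
apply: (@le_lt_trans _ _ (Normc.normc z * (2 * t k))).
  by rewrite ler_pM2l// -[t k in leRHS]gtr0_norm// cayley_near1.
have -> : Normc.normc z * (2 * t k) = d / k.+2%:R.
  have tE (a b c : R) : a != 0 -> c != 0 -> a * (2 * (b / (2 * a) / c)) = b / c.
    by move=> a0 c0; field; rewrite c0 a0.
  by apply: tE; rewrite ?pnatr_eq0// gt_eqF.
by rewrite ltr_pdivrMr// ltr_pMr// ltr1n.
Qed.

Lemma normcR (R : realType) (s : R) : 0 <= s -> Normc.normc s%:C = s.
Proof.
by move=> s0; apply: complexI; rewrite -complex_normE ger0_norm// lecR.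
Qed.

Lemma approx_outside (R : realType) (z : R[i]) (d : R) : 0 < d ->
  exists2 y, Normc.normc (y - z) < d & Normc.normc z < Normc.normc y.
Proof.
move=> d0; have [->|z0] := eqVneq z 0.
  by exists (d / 2)%:C; rewrite ?subr0 ?Normc.normc0 normcR; lra.
have nz : 0 < Normc.normc z by rewrite -ltcR -complex_normE normr_gt0.
pose t := d / 2 / Normc.normc z; have t0 : 0 < t by rewrite !divr_gt0.
exists ((1 + t)%:C * z).
  rewrite -[X in _ - X]mul1r -mulrBl rmorphD/= addrAC subrr add0r Normc.normcM.
  by rewrite normcR ?ltW// divfK ?gt_eqF//; lra.
rewrite Normc.normcM normcR; last by lra.
by rewrite ltr_pMl//; lra.
Qed.

Lemma approx_inside (R : realType) (z : R[i]) (d : R) : z != 0 -> 0 < d ->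
  exists y, [/\ y != 0, Normc.normc (y - z) < d & Normc.normc y < Normc.normc z].
Proof.
move=> z0 d0.
have nz : 0 < Normc.normc z by rewrite -ltcR -complex_normE normr_gt0.
pose n := Normc.normc z; pose t := n / (n + d).
have nd : 0 < n + d by rewrite addr_gt0.
have t0 : 0 < t by rewrite divr_gt0.
have t1 : t < 1 by rewrite ltr_pdivrMr// mul1r ltrDl.
exists (t%:C * z); split.
- by rewrite mulf_neq0// fmorph_eq0 gt_eqF.
- rewrite -normcN opprB -[X in X - _]mul1r -mulrBl -(rmorph1 (real_complex R)) -rmorphB/=.
  rewrite Normc.normcM normcR ?subr_ge0 ?ltW// (_ : 1 - t = d / (n + d)).
    by rewrite -/n mulrAC ltr_pdivrMr// ltr_pM2l// ltrDl.
  by rewrite /t; field; rewrite gt_eqF.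
- by rewrite Normc.normcM normcR ?ltW// gtr_pMl.
Qed.

(** * The local spectrum is the closed annulus *)

Lemma lte_fin_dense (R : realType) (a : R) (x : \bar R) : (a%:E < x)%E ->
  exists2 r : R, a < r & (r%:E < x)%E.
Proof.
case: x => [b| |]//; last by exists (a + 1); rewrite ?ltry// ltrDl.
by rewrite lte_fin => ab; exists ((a + b) / 2); rewrite ?lte_fin; lra.
Qed.

Lemma gte_fin_dense (R : realType) (a : R) (x : \bar R) : (x < a%:E)%E ->
  exists2 r : R, (x < r%:E)%E & r < a.
Proof.
case: x => [b| |]//; last by exists (a - 1); rewrite ?ltNyr// gtrBl.
by rewrite lte_fin => ab; exists ((a + b) / 2); rewrite ?lte_fin; lra.
Qed.

Section Converse.
Variables (R : realType) (H : completeNormedModType R[i]).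
Variables (dot : {dot H for (@Num.conj R[i])}) (e : int -> H).
Hypotheses (hdot : inner_product_norm dot) (he : orthonormal_basis dot e).
Variables (w : int -> R) (w_gt0 : forall n : int, 0 < w n).
Variables (S : {linear H -> H}) (hS : bilateral_weighted_shift e w S).

(** The coordinate on the rescaled basis [shifted_basis]. *)
Definition ncoef (v : H) (n : int) : R[i] := dot v (e n) / (beta w n)%:C.

Lemma betaC_neq0 n : (beta w n)%:C != 0 :> R[i].
Proof. by rewrite fmorph_eq0 gt_eqF// beta_gt0. Qed.

Lemma ncoef_eq0 v n : (ncoef v n == 0) = (dot v (e n) == 0).
Proof. by rewrite mulf_eq0 invr_eq0 (negbTE (betaC_neq0 n)) orbF. Qed.

Lemma ncoef_le v n : `|ncoef v n| <= `|v| * ((beta w n)^-1)%:C.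
Proof.
rewrite normrM normfV (ger0_norm (_ : 0 <= (beta w n)%:C)); last first.
  by rewrite lecR ltW// beta_gt0.
by rewrite -fmorphV/= ler_wpM2r ?coord_le_norm// lecR invr_ge0 ltW// beta_gt0.
Qed.

Lemma ncoef_recurrence x z v n : S v - z *: v = x ->
  ncoef v n - z * ncoef v (n + 1) = ncoef x (n + 1).
Proof.
move=> <-; rewrite /ncoef linearBl/= linearZl_LR/= (coord_shift hdot he w_gt0 hS).
rewrite betaS// rmorphM/= mulrBl mulrA; congr (_ - _).
by rewrite -mulf_div mulfV ?mul1r// fmorph_eq0 gt_eqF.
Qed.

(** To the right of the support of [x], [ncoef v n = z ^ k * ncoef v (n + k)],
while [ncoef v m] is at most [`|v| / beta m].  If [ncoef v n] were non-zero,
[beta m] would be at most a constant times [|z| ^ m], and its root growth rate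
at most [|z|]. *)
Lemma ncoef_right_eq0 x z v (n : nat) : S v - z *: v = x ->
  (forall j : nat, (n < j)%N -> dot x (e j) = 0) ->
  z != 0 -> ((Normc.normc z)%:E < r3_plus w)%E -> ncoef v n = 0.
Proof.
move=> vx x0 z0 zr; apply/eqP/negPn/negP => vn.
have [c c0 vnE] := normed_real (V := R[i]^o) (ncoef v n).
have [t t0 vt] := normed_real v.
have nz : 0 < Normc.normc z by rewrite -ltcR -complex_normE normr_gt0.
have cgt0 : 0 < c by rewrite -ltcR -vnE normr_gt0.
move: zr; rewrite ltNge => /negP; apply.
apply: (@limn_esup_le_geometric _ _ (t / c / Normc.normc z ^+ n)).
- exact: normc_ge0.
- by move=> m; exact: beta_gt0.
exists n => // m /= nm; rewrite -(subnKC nm); move: (m - n)%N => k.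
have : ncoef v n = z ^+ k * ncoef v (n%:Z + k%:Z).
  apply: (homogeneous_recurrence (fun n => ncoef_recurrence n vx)) => j _.
  by rewrite /ncoef x0 ?mul0r//; lia.
move=> /(congr1 Num.norm); rewrite vnE normrM normrX complex_normE => cE.
have b0 : 0 < beta w (n + k)%N by exact: beta_gt0.
have := ncoef_le v (n + k)%N; set b := beta w (n + k)%N in b0 *.
rewrite PoszD -(@ler_pM2l _ ((Normc.normc z)%:C ^+ k)) ?exprn_gt0 ?ltcR//.
rewrite -cE vt -rmorphXn/= -!rmorphM/= lecR mulrA ler_pdivlMr// => h.
rewrite exprD mulrA divfK ?gt_eqF ?exprn_gt0// mulrAC ler_pdivlMr//.
by rewrite mulrC [t * _]mulrC.
Qed.

(** The mirror image of [ncoef_right_eq0]: to the left of the support,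
[ncoef v (- m)] is a constant times [z ^ (m - n)] and at most
[`|v| / beta (- m)], which would bound [1 / beta (- m)] from below by a
constant times [|z| ^ m]. *)
Lemma ncoef_left_eq0 x z v (n : nat) : S v - z *: v = x ->
  (forall j : nat, (n <= j)%N -> dot x (e (- j%:Z)) = 0) ->
  (r2_minus w < (Normc.normc z)%:E)%E -> ncoef v (- n%:Z) = 0.
Proof.
move=> vx x0 zr; apply/eqP/negPn/negP => vn.
have [c c0 vnE] := normed_real (V := R[i]^o) (ncoef v (- n%:Z)).
have [t t0 vt] := normed_real v.
have cgt0 : 0 < c by rewrite -ltcR -vnE normr_gt0.
move: zr; rewrite ltNge => /negP; apply.
apply: (@limn_einf_ge_geometric _ _ (t / c * Normc.normc z ^+ n)).
- exact: normc_ge0.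
- by move=> m; rewrite divr_gt0// beta_gt0.
exists n => // m /= nm; rewrite -(subnKC nm); move: (m - n)%N => k.
have : ncoef v (- (n + k)%N%:Z) = z ^+ k * ncoef v (- n%:Z).
  rewrite [in RHS](_ : - n%:Z = - (n + k)%N%:Z + k%:Z); last by lia.
  apply: (homogeneous_recurrence (fun n => ncoef_recurrence n vx)) => j jk.
  rewrite /ncoef (_ : _ + _ = - (n + (k - j.+1))%N%:Z); last by lia.
  by rewrite x0 ?mul0r// leq_addr.
move=> /(congr1 Num.norm); rewrite [in RHS]normrM normrX (complex_normE z) vnE => cE.
have := ncoef_le v (- (n + k)%N%:Z); set b := beta w _.
rewrite cE vt -rmorphXn/= -!rmorphM/= lecR => h.
rewrite exprD div1r -mulrA mulrCA.
rewrite ler_wpM2l ?exprn_ge0 ?normc_ge0//.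
by rewrite mulrAC ler_pdivlMr.
Qed.

(** An analytic [f] is continuous, and so are its coordinates; this carries their
vanishing from a set of points accumulating at [z] to [z] itself. *)
Lemma ncoef_eq0_limit (f : R[i] -> H) (U : set R[i]) z n :
  open (U : set R[i]^o) -> analytic_on U f -> U z ->
  (forall d : R, 0 < d -> exists2 y, Normc.normc (y - z) < d &
     U y -> ncoef (f y) n = 0) ->
  ncoef (f z) n = 0.
Proof.
move=> /open_regularP oU fU Uz near0.
suff: dot (f z) (e n) == 0 by rewrite -ncoef_eq0 => /eqP.
apply/negPn/negP => fz.
have [d1 /complex_gt0P[{}d1 d10 ->] Ud1] := oU z Uz.
have [|d2 /complex_gt0P[{}d2 d20 ->] fd2] :=
  @derivable_continuous_norm _ _ f z (fU z Uz) `|dot (f z) (e n)|.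
  by rewrite normr_gt0.
have [|y yz fy] := near0 (Num.min d1 d2); first by rewrite lt_min d10.
move: yz; rewrite lt_min => /andP[y1 y2].
have Uy : U y by apply: Ud1; rewrite complex_normE ltcR.
have /eqP : ncoef (f y) n = 0 by exact: fy.
rewrite ncoef_eq0 => /eqP fyn.
have : `|f y - f z| < `|dot (f z) (e n)| by apply: fd2; rewrite complex_normE ltcR.
have := coord_le_norm hdot he (f y - f z) n.
rewrite linearBl/= fyn sub0r normrN => /le_lt_trans/[apply].
by rewrite ltxx.
Qed.

Lemma annulus_not_local_resolvent x lam : finite_span e x -> x <> 0 ->
  (r2_minus w <= (Normc.normc lam)%:E)%E -> ((Normc.normc lam)%:E <= r3_plus w)%E ->
  ~ local_resolvent_set S x lam.
Proof.
move=> xspan xn0 r2lam lamr3 [U [oU [f [fU fx]]] Ulam].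
apply: xn0; apply: (span_coord_eq0 hdot xspan).
have [K xK] := span_coord_support he xspan.
suff ycoef n : (`|n| <= K)%N -> ncoef x n = 0.
  move=> n; have [/ycoef/eqP|/xK//] := leqP `|n| K.
  by rewrite ncoef_eq0 => /eqP.
have left0 z : U z -> (r2_minus w <= (Normc.normc z)%:E)%E ->
    ncoef (f z) (- K.+1%:Z) = 0.
  move=> Uz r2z; apply: (ncoef_eq0_limit oU fU Uz) => d /(approx_outside z)[y yz zy].
  exists y => // Uy; apply: (ncoef_left_eq0 (fx y Uy)).
    by move=> j Kj; apply: xK; lia.
  by apply: le_lt_trans r2z _; rewrite lte_fin.
have right0 z : U z -> z != 0 -> ((Normc.normc z)%:E <= r3_plus w)%E ->
    ncoef (f z) K = 0.
  move=> Uz z0 zr3; apply: (ncoef_eq0_limit oU fU Uz) => d d0.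
  have [y [y0 yz zy]] := approx_inside z0 d0.
  exists y => // Uy; apply: (ncoef_right_eq0 (fx y Uy)) => //.
    by move=> j Kj; apply: xK.
  by apply: lt_le_trans zr3; rewrite lte_fin.
have [lam0|lam0] := eqVneq lam 0.
  (* Here [r2 = 0], so the coordinates to the left of the support vanish on all
     of [U].  If the coordinate of index [n] vanishes on [U], the recurrence at
     the point 0 gives [ncoef x (n + 1) = 0]; at the other points of [U] it then
     gives [ncoef (f z) (n + 1) = 0], which extends to 0 by continuity. *)
  have r20 z : (r2_minus w <= (Normc.normc z)%:E)%E.
    apply: le_trans r2lam _; rewrite lam0 Normc.normc0 lee_fin; exact: normc_ge0.
  have all0 (j : nat) : forall z, U z -> ncoef (f z) (- K.+1%:Z + j%:Z) = 0.
    elim: j => [|j IH] z Uz; first by rewrite addr0 left0.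
    have step y : U y -> - (y * ncoef (f y) (- K.+1%:Z + j.+1%:Z)) =
        ncoef x (- K.+1%:Z + j.+1%:Z).
      move=> Uy; have := ncoef_recurrence (- K.+1%:Z + j%:Z) (fx y Uy).
      rewrite IH// sub0r (_ : - K.+1%:Z + j%:Z + 1 = - K.+1%:Z + j.+1%:Z)//; lia.
    have x0 : ncoef x (- K.+1%:Z + j.+1%:Z) = 0.
      by rewrite -(step lam)// lam0 mul0r oppr0.
    apply: (ncoef_eq0_limit oU fU Uz) => d /(approx_outside z)[y yz zy].
    exists y => // Uy; have /eqP := step y Uy.
    rewrite x0 oppr_eq0 mulf_eq0 => /orP[/eqP y0|/eqP//].
    by move: zy; rewrite y0 Normc.normc0 ltNge normc_ge0.
  move=> nK; have nE : n = - K.+1%:Z + (absz (n + K%:Z))%:Z + 1 by lia.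
  rewrite nE -(ncoef_recurrence _ (fx lam Ulam)).
  by rewrite all0// sub0r {1}lam0 mul0r oppr0.
move=> nK.
(* The indices of [p] cover the positions from [- K] to [K], that is the support
   of [x]; the telescoped sum runs from [- K - 1] to [K]. *)
pose p := \poly_(j < (K.+1 + K)%N) ncoef x (- K.+1%:Z + j.+1%:Z).
have p0 : p = 0.
  have /open_regularP/(_ lam Ulam)[d /complex_gt0P[{}d d0 ->] dU] := oU.
  apply: (poly_vanish_arc lam0 d0) => z zlam znorm.
  have Uz : U z by apply: dU; rewrite complex_normE ltcR.
  have z0 : z != 0.
    by rewrite -normr_eq0 complex_normE znorm -complex_normE normr_eq0.
  rewrite horner_poly -(recurrence_telescope _ _ (fun n => ncoef_recurrence n (fx z Uz))).
  rewrite (_ : - K.+1%:Z + (K.+1 + K)%N%:Z = K%:Z); last by lia.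
  by rewrite left0 ?znorm// right0 ?znorm// mulr0 subrr.
have nE : n = - K.+1%:Z + (absz (n + K%:Z)).+1%:Z by lia.
have : p`_(absz (n + K%:Z)) = 0 by rewrite p0 coef0.
rewrite coef_poly -nE ifT//; lia.
Qed.

(** A radius [r] strictly between [|lam|] and the critical radius turns the limit
inferior or superior into a geometric bound with a uniform constant. *)
Lemma local_resolvent_off_annulus x lam : finite_span e x ->
  ((Normc.normc lam)%:E < r2_minus w)%E \/ (r3_plus w < (Normc.normc lam)%:E)%E ->
  local_resolvent_set S x lam.
Proof.
move=> xspan [lr2|r3l].
  have [r lr rr2] := lte_fin_dense lr2.
  have r0 : 0 < r by exact: le_lt_trans (normc_ge0 _) lr.
  have [n|C uC] := limn_einf_gt_geometric r0 _ rr2.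
    by rewrite divr_gt0// beta_gt0.
  have go : geometric_growth r^-1 (fun k => shifted_basis e w (- k%:Z)).
    exists C => k; rewrite (norm_shifted_basis hdot he)// lecR; apply: le_trans (uC k).
    by rewrite div1r invrK.
  have rV0 : 0 < r^-1 by rewrite invr_gt0.
  have [a [a0 aS ga]] := backward_orbit hdot he w_gt0 hS rV0 go xspan.
  exact: local_resolvent_inner hS.1 a0 aS r0 ga lr.
have [r r3r rl] := gte_fin_dense r3l.
have [n|C uC] := limn_esup_lt_geometric _ r3r; first exact: beta_gt0.
have r0 : 0 < r.
  by rewrite -lte_fin; apply: le_lt_trans r3r; exact: r3_plus_ge0.
have gx : geometric_growth r (fun k => iter k S x).
  apply: (growth_iter hdot he w_gt0 hS r0 _ xspan).
  by exists C => k; rewrite (norm_shifted_basis hdot he)// lecR.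
exact: local_resolvent_outer hS.1 r0 gx rl.
Qed.

End Converse.

Theorem proposition4p6 (R : realType) (H : completeNormedModType R[i])
    (dot : {dot H for (@Num.conj R[i])}) (hdot : inner_product_norm dot)
    (e : int -> H) (he : orthonormal_basis dot e)
    (w : int -> R) (w_gt0 : forall n : int, 0 < w n)
    (w_bounded : exists M : R, forall n : int, w n <= M)
    (S : {linear H -> H}) (hS : bilateral_weighted_shift e w S)
    (x : H) (hx : finite_span e x) (x_neq0 : x <> 0) :
  local_spectrum S x =
    [set lam : R[i] |
      (r2_minus w <= (Normc.normc lam)%:E <= r3_plus w)%E].
Proof.
apply/seteqP; split=> lam /=; last first.
  by move=> /andP[r2 r3]; exact: (annulus_not_local_resolvent hdot he w_gt0 hS).
move=> xlam; apply/andP; split; rewrite leNgt; apply/negP => lamr; apply: xlam.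
  by apply: (local_resolvent_off_annulus hdot he w_gt0 hS hx); left.
by apply: (local_resolvent_off_annulus hdot he w_gt0 hS hx); right.
Qed.
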